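(* Let $X$ and $Y$ be connected nontrivial graphs with $Y$ not homeomorphic to the circle $S^1$, and let $f,g: X \to Y$ be continuous maps. Then $f$ and $g$ can be changed by homotopy to be coincidence free; that is, there exist continuous maps $f',g': X\to Y$ with $f'$ homotopic to $f$ and $g'$ homotopic to $g$ such that $\operatorname{Coin}(f',g')=\emptyset$.
   Context: A graph is a CW-complex of dimension $1$; nontrivial means it is not a single point. Maps of graphs are arbitrary continuous maps of the underlying topological spaces (not required to be cellular). For continuous maps $f,g:X\to Y$, the coincidence set is $\operatorname{Coin}(f,g)=\{x\in X \mid f(x)=g(x)\}$, and the pair is coincidence free if this set is empty. Both maps may be changed, each by its own free homotopy. *)

(* Defs.v *)
From HB Require Import structures.
From mathcomp Require Import all_boot all_order all_algebra.
From mathcomp Require Import all_classical all_reals all_analysis.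
Set Implicit Arguments.
Unset Strict Implicit.
Unset Printing Implicit Defensive.
Import Order.TTheory GRing.Theory Num.Theory numFieldNormedType.Exports.
Local Open Scope classical_set_scope.
Local Open Scope ring_scope.

(* A CW structure of dimension at most 1 on X: the 0-cells are the points of V,
   the 1-cells are indexed by E, and phi e restricted to `[0, 1] is the
   characteristic map of e; the values of phi e outside `[0, 1] are irrelevant.
   The families may be infinite. Closure finiteness holds because the boundary
   of a 1-cell has at most two points. Injectivity on `]0, 1[ makes phi e a
   homeomorphism from `]0, 1[ onto the open cell, as `[0, 1] is compact, X is
   Hausdorff, and the endpoints are mapped outside the open cell. *)
Record cw1_structure (R : realType) (X : topologicalType) (V : set X)
    (E : Type) (phi : E -> R -> X) : Prop := Cw1Structure {
  cw1_hausdorff : hausdorff_space X;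
  cw1_continuous : forall e, {within `[0, 1], continuous (phi e)};
  cw1_boundary : forall e, V (phi e 0) /\ V (phi e 1);
  cw1_inj : forall e, {in `]0, 1[ &, injective (phi e)};
  cw1_disj0 : forall e (t : R), t \in `]0, 1[ -> ~ V (phi e t);
  cw1_disj1 : forall e e' (t t' : R),
    t \in `]0, 1[ -> t' \in `]0, 1[ ->
    phi e t = phi e' t' -> e = e';
  cw1_cover : forall x,
    V x \/ exists e, exists2 t : R, t \in `]0, 1[ & phi e t = x;
  (* weak topology; the converse implication follows from cw1_continuous, and
     0-cells impose no condition on A *)
  cw1_weak : forall A : set X,
    (forall e, closed (`[0, 1] `&` phi e @^-1` A)) -> closed A
}.

(* The case E = void is allowed; a connected nontrivial graph always has a
   1-cell, so there dimension at most 1 means dimension exactly 1. *)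
Definition is_graph (R : realType) (X : topologicalType) : Prop :=
  exists (V : set X) (E : Type) (phi : E -> R -> X), cw1_structure V phi.

Definition nontrivial (X : Type) : Prop := exists x y : X, x <> y.

Definition homeomorphic (T U : topologicalType) : Prop :=
  exists (h : T -> U) (k : U -> T),
    [/\ continuous h, continuous k, cancel h k & cancel k h].

Definition unit_circle (R : realType) : set (R * R) :=
  [set p | p.1 ^+ 2 + p.2 ^+ 2 = 1].
Arguments unit_circle : clear implicits.

Definition homotopic (R : realType) (X Y : topologicalType) (f g : X -> Y) :
    Prop :=
  exists H : X * R -> Y,
    [/\ {within [set: X] `*` `[0, 1], continuous H},
        forall x, H (x, 0) = f x & forall x, H (x, 1) = g x].

Definition Coin (X Y : Type) (f g : X -> Y) : set X := [set x | f x = g x].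

(* Main.v *)
Require Import Defs.
From HB Require Import structures.
From mathcomp Require Import all_boot all_order all_algebra.
From mathcomp Require Import all_classical all_reals all_analysis.
From mathcomp Require Import lra.
Import Order.TTheory GRing.Theory Num.Theory.
Import numFieldNormedType.Exports.
Local Open Scope classical_set_scope.
Local Open Scope ring_scope.
Set Implicit Arguments.
Unset Strict Implicit.
Unset Printing Implicit Defensive.

(** Fix two points a and b of Y. Moving the images of the vertices of X along
    paths, f may be assumed to be a on the second half of every edge of X and g
    to be b on the first half, so that everywhere f = a or g = b. It remains to
    make the maps (id, b) and (a, id) from Y to Y x Y avoid the diagonal.

    If Y has a branch vertex, choose a and b on one of three edge germs there.
    When the moving point comes near the resting one, push both through the
    branch vertex, one onto the second germ and the other onto the third; only a
    neighbourhood of the resting point is concerned, so the two homotopies agree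
    at (a, b).

    Otherwise, if some edge is not a bridge, it lies on a cycle, which is all of
    Y for want of branch vertices, and Y is a circle. If all edges are bridges,
    Y is a tree, hence contractible to either end of an edge, and f and g are
    homotopic to two distinct constants. *)

(** * Continuity rules and pasting *)

Section ContinuityRules.
Context {R : realType}.
Implicit Types T U W : topologicalType.

Lemma cont_comp T U W (g : U -> W) (f : T -> U) :
  continuous g -> continuous f -> continuous (fun x => g (f x)).
Proof. by move=> cg cf x; apply: (@continuous_comp _ _ _ f g); [exact: cf|exact: cg]. Qed.

Lemma cont_pair T U W (f : T -> U) (g : T -> W) :
  continuous f -> continuous g -> continuous (fun x => (f x, g x)).
Proof. by move=> cf cg x; apply: cvg_pair; [exact: cf|exact: cg]. Qed.

Lemma cont_fst T U W (f : T -> U * W) :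
  continuous f -> continuous (fun x => (f x).1).
Proof. by apply: cont_comp => x; exact: cvg_fst. Qed.

Lemma cont_snd T U W (f : T -> U * W) :
  continuous f -> continuous (fun x => (f x).2).
Proof. by apply: cont_comp => x; exact: cvg_snd. Qed.

Lemma cont_add T (f g : T -> R) :
  continuous f -> continuous g -> continuous (fun x => f x + g x).
Proof. by move=> cf cg x; apply: cvgD; [exact: cf|exact: cg]. Qed.

Lemma cont_opp T (f : T -> R) : continuous f -> continuous (fun x => - f x).
Proof. by move=> cf x; apply: cvgN; exact: cf. Qed.

Lemma cont_mul T (f g : T -> R) :
  continuous f -> continuous g -> continuous (fun x => f x * g x).
Proof. by move=> cf cg x; apply: cvgM; [exact: cf|exact: cg]. Qed.

Lemma cont_norm T (f : T -> R) : continuous f -> continuous (fun x => `|f x|).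
Proof. by move=> cf x; apply: cvg_norm; exact: cf. Qed.

Lemma cont_max T (f g : T -> R) :
  continuous f -> continuous g -> continuous (fun x => Num.max (f x) (g x)).
Proof.
move=> cf cg.
exact: (cont_comp (@max_continuous _ R) (cont_pair cf cg)).
Qed.

Lemma cont_min T (f g : T -> R) :
  continuous f -> continuous g -> continuous (fun x => Num.min (f x) (g x)).
Proof.
move=> cf cg.
exact: (cont_comp (@min_continuous _ R) (cont_pair cf cg)).
Qed.

Lemma cont_cst T U (c : U) : continuous (fun _ : T => c).
Proof. by move=> x; exact: cvg_cst. Qed.

Lemma cont_id T : continuous (fun x : T => x).
Proof. by move=> x; exact: cvg_id. Qed.

(** The pasting lemma for two closed sets. The test [P] itself need not be closed: a point of [A]
    where [P] fails also lies in [B], and there the two maps agree. *)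
Lemma cont_glue T U (A B : set T) (P : T -> bool) (f g : T -> U) :
  closed A -> closed B ->
  (forall x, P x -> A x) -> (forall x, ~~ P x -> B x) ->
  (forall x, A x -> B x -> f x = g x) ->
  {within A, continuous f} -> {within B, continuous g} ->
  continuous (fun x => if P x then f x else g x).
Proof.
move=> clA clB PA PB fg cf cg; apply/continuous_subspace_setT.
have <- : A `|` B = setT.
  rewrite -subTset => x _.
  by case: (boolP (P x)) => [/PA|/PB]; [left|right].
apply: withinU_continuous => //.
- apply: subspace_eq_continuous cf => x /set_mem Ax /=.
  by rewrite /from_subspace; case: ifPn => // /PB Bx; exact: fg.
- apply: subspace_eq_continuous cg => x /set_mem Bx /=.
  by rewrite /from_subspace; case: ifPn => // /PA Ax; exact/esym/fg.
Qed.

Lemma closed_le_fun T (f g : T -> R) :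
  continuous f -> continuous g -> closed [set x | f x <= g x].
Proof.
move=> cf cg.
have -> : [set x | f x <= g x] = (fun x => g x - f x) @^-1` [set y | 0 <= y].
  by apply/seteqP; split => x /=; rewrite subr_ge0.
apply: closed_comp; last exact: closed_ge.
by move=> x _; apply: (cont_add cg (cont_opp cf)).
Qed.

Lemma cont_if_le T U (a b : T -> R) (f g : T -> U) :
  continuous a -> continuous b -> continuous f -> continuous g ->
  (forall x, a x = b x -> f x = g x) ->
  continuous (fun x => if a x <= b x then f x else g x).
Proof.
move=> ca cb cf cg fg.
apply: (@cont_glue _ _ [set x | a x <= b x] [set x | b x <= a x]).
- exact: closed_le_fun.
- exact: closed_le_fun.
- by [].
- by move=> x; rewrite -ltNge => /ltW.
- by move=> x /= h1 h2; apply: fg; apply/eqP; rewrite eq_le h1 h2.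
- exact: continuous_subspaceT.
- exact: continuous_subspaceT.
Qed.

End ContinuityRules.

(** * Retraction of the line onto the unit interval *)

Definition clamp {R : realType} (t : R) : R := Num.max 0 (Num.min 1 t).

Section Clamp.
Context {R : realType}.
Implicit Types t : R.

Lemma clamp_id t : 0 <= t <= 1 -> clamp t = t.
Proof. by move=> /andP[t0 t1]; rewrite /clamp min_r// max_r. Qed.

Lemma clamp0 t : t <= 0 -> clamp t = 0.
Proof. by move=> t0; rewrite /clamp min_r ?max_l//; lra. Qed.

Lemma clamp1 t : 1 <= t -> clamp t = 1.
Proof. by move=> t0; rewrite /clamp min_l // max_r // ler01. Qed.

Lemma clamp_itv t : 0 <= clamp t <= 1.
Proof. by rewrite /clamp le_max lexx ge_max ler01 ge_min lexx. Qed.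

Lemma clampB t : clamp (1 - t) = 1 - clamp t.
Proof.
case: (leP t 0) => [t0|t0]; first by rewrite clamp1 ?clamp0; lra.
case: (leP 1 t) => [t1|t1]; first by rewrite clamp0 ?clamp1; lra.
by rewrite !clamp_id; lra.
Qed.

Lemma cont_clamp (T : topologicalType) (f : T -> R) :
  continuous f -> continuous (fun x => clamp (f x)).
Proof.
move=> cf; rewrite /clamp; apply: cont_max; first exact: cont_cst.
by apply: cont_min => //; exact: cont_cst.
Qed.

(** Characteristic maps are controlled on the unit interval only. With a clamped parameter, this
    lemma turns them into maps continuous on the whole line. *)
Lemma cont_within_clamp (T U : topologicalType) (p : R -> U) (f : T -> R) :
  {within `[0, 1], continuous p} -> continuous f ->
  (forall x, f x \in `[0, 1]) ->
  continuous (fun x => p (f x)).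
Proof.
move=> /subspace_continuousP cp cf f01 x.
apply: cvg_comp (cp _ (f01 x)).
by move=> W /= nW; apply: (@filterS _ (nbhs x) _ _ _ _ (cf x _ nW)) => y /= /(_ (f01 y)).
Qed.

End Clamp.

Ltac cont_step := match goal with
  | H : continuous _ |- _ => exact H
  | |- continuous fst => exact: (cont_fst (@cont_id _))
  | |- continuous snd => exact: (cont_snd (@cont_id _))
  | |- continuous (GRing.mul ?c) =>
      exact: (cont_mul (@cont_cst _ _ c) (@cont_id _))
  | |- continuous (GRing.add ?c) =>
      exact: (cont_add (@cont_cst _ _ c) (@cont_id _))
  | |- continuous (@GRing.opp _) => exact: (cont_opp (@cont_id _))
  | |- continuous clamp => exact: (cont_clamp (@cont_id _))
  | |- continuous (fun x => clamp (@?f x)) => apply: (@cont_clamp _ _ f)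
  | |- continuous (fun _ => ?c) => exact: cont_cst
  | |- continuous (fun x => x) => exact: cont_id
  | |- continuous (fun x => (@?f x) + (@?g x)) => apply: (@cont_add _ _ f g)
  | |- continuous (fun x => - (@?f x)) => apply: (@cont_opp _ _ f)
  | |- continuous (fun x => (@?f x) * (@?g x)) => apply: (@cont_mul _ _ f g)
  | |- continuous (fun x => `|@?f x|) => apply: (@cont_norm _ _ f)
  | |- continuous (fun x => Num.max (@?f x) (@?g x)) => apply: (@cont_max _ _ f g)
  | |- continuous (fun x => Num.min (@?f x) (@?g x)) => apply: (@cont_min _ _ f g)
  | |- continuous (fun x => (@?f x, @?g x)) => apply: (@cont_pair _ _ _ f g)
  | |- continuous (fun x => (@?f x).1) => apply: (@cont_fst _ _ _ f)
  | |- continuous (fun x => (@?f x).2) => apply: (@cont_snd _ _ _ f)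
  end.
Ltac cont := repeat cont_step.

(** * Maps out of a graph, connectedness, and oriented edges *)

Section CwTheory.
Context {R : realType} {X : topologicalType} {V : set X} {E : Type}
  {phi : E -> R -> X} (S : cw1_structure V phi).

Lemma cw_cont (U : topologicalType) (h : X -> U) :
  (forall e, {within `[0, 1], continuous (fun t => h (phi e t))}) ->
  continuous h.
Proof.
move=> ch; apply/continuous_closedP => A clA.
apply: (cw1_weak S) => e.
have /continuous_closedP/(_ _ clA) := ch e.
have c01 : closed [set` `[0 : R, 1]] by exact: interval_closed.
by rewrite -(closed_setIS _ c01) setIC.
Qed.

Lemma endpoint_or_interior (t : R) :
  t \in `[0, 1] -> [\/ t = 0, t = 1 | t \in `]0, 1[].
Proof.
rewrite !in_itv /= => /andP[t0 t1].
case: (eqVneq t 0) => [->|tn0]; first by constructor 1.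
case: (eqVneq t 1) => [->|tn1]; first by constructor 2.
by constructor 3; rewrite !lt_neqAle eq_sym tn0 t0 tn1.
Qed.

Section ArrowTopology.
Import ArrowAsCompactOpen.

(* Curried, a homotopy is a map from X to R -> Z with the compact-open topology,
   and for such maps continuity can be tested on the cells. *)
Lemma cw_homotopy (Z : topologicalType) (kv : X -> R -> Z)
    (ke : E -> R -> R -> Z) :
  (forall v, V v -> continuous (kv v)) ->
  (forall e, continuous (fun p : R * R => ke e p.1 p.2)) ->
  (forall e s, ke e 0 s = kv (phi e 0) s) ->
  (forall e s, ke e 1 s = kv (phi e 1) s) ->
  exists H : X * R -> Z, [/\ continuous H,
    forall v s, V v -> H (v, s) = kv v s &
    forall e (t s : R), t \in `[0, 1] -> H (phi e t, s) = ke e t s].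
Proof.
move=> ckv cke ke0 ke1.
(* The cells partition [X], so each point takes its value from its own cell; [hV] and [hE] show that
   the value is the expected one, also at the ends of edges. *)
have /choice[h hP] : forall x, exists w, (V x /\ w = kv x) \/
    (exists e t, [/\ t \in `]0, 1[, phi e t = x & w = ke e t]).
  move=> x; case: (cw1_cover S x) => [Vx|[e [t t01 <-]]].
    by exists (kv x); left.
  by exists (ke e t); right; exists e, t.
have hV v : V v -> h v = kv v.
  move=> Vv; case: (hP v) => [[]//|[e [t [t01 ev _]]]].
  by exfalso; apply: (cw1_disj0 S (e := e) t01); rewrite ev.
have hE e t : t \in `[0, 1] -> h (phi e t) = ke e t.
  case/endpoint_or_interior => [->|->|t01].
  - rewrite hV; last by case: (cw1_boundary S e).
    by apply/funext => s; rewrite ke0.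
  - rewrite hV; last by case: (cw1_boundary S e).
    by apply/funext => s; rewrite ke1.
  - case: (hP (phi e t)) => [[/(cw1_disj0 S t01)]//|[e' [t' [t'01 ee ->]]]].
    have e'e := cw1_disj1 S t'01 t01 ee; rewrite e'e in ee *.
    by rewrite (cw1_inj S t'01 t01 ee).
have ch : continuous h.
  apply: cw_cont => e.
  apply: (@subspace_eq_continuous _ _ _ (ke e)).
    by move=> t /set_mem t01; rewrite /from_subspace hE.
  apply: continuous_subspaceT.
  exact: (continuous_curry_fun (cke e)).
exists (uncurry h); split=> //.
(* Continuity for the product topology comes from local compactness of the time line. *)
- apply: continuous_uncurry => //.
  + exact: locally_compactR.
  + move=> x; case: (hP x) => [[Vx ->]|[e [t [_ _ ->]]]]; first exact: ckv.
    have [_] := continuous_curry (cke e).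
    exact.
- by move=> v s Vv /=; rewrite hV.
- by move=> e t s t01 /=; rewrite hE.
Qed.

End ArrowTopology.

(** A set containing every closed edge that it meets is closed, its trace on each unit interval
    being everything or empty. The complement has the same property, so [C] is open and closed. *)
Lemma saturated_setT (C : set X) :
  connected [set: X] -> C !=set0 ->
  (forall e (t t' : R), t \in `[0, 1] -> t' \in `[0, 1] ->
     C (phi e t) -> C (phi e t')) -> C = setT.
Proof.
move=> conn C0 sat.
have clsat (D : set X) : (forall e (t t' : R), t \in `[0, 1] -> t' \in `[0, 1] ->
     D (phi e t) -> D (phi e t')) -> closed D.
  move=> Dsat; apply: (cw1_weak S) => e.
  have [De|nDe] := pselect (D (phi e 0)).
    have -> : `[0, 1]%classic `&` phi e @^-1` D = `[0, 1]%classic.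
      apply/seteqP; split => [t []//|t t01]; split => //.
      by apply: Dsat De => //; rewrite in_itv /= lexx ler01.
    exact: interval_closed.
  have -> : `[0, 1]%classic `&` phi e @^-1` D = set0.
    apply/seteqP; split => // t [t01 Dt]; apply: nDe.
    by apply: Dsat Dt => //; rewrite in_itv /= lexx ler01.
  exact: closed0.
apply: conn => //.
- exists C; last by rewrite setTI.
  rewrite -(setCK C) openC; apply: clsat => e t t' t01 t'01 /= nC Ct'.
  by apply: nC; apply: sat Ct'.
- by exists C; [exact: clsat|rewrite setTI].
Qed.

(** A dart is an edge with a direction. Branching is measured by the darts starting at a vertex, so
    that a loop counts twice. *)
Definition dart_path (d : E * bool) (t : R) : X :=
  phi d.1 (if d.2 then 1 - clamp t else clamp t).

Definition dart_rev (d : E * bool) : E * bool := (d.1, ~~ d.2).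

Lemma cont_dart_path (T : topologicalType) d (f : T -> R) :
  continuous f -> continuous (fun x => dart_path d (f x)).
Proof.
move=> cf; apply: (@cont_within_clamp _ _ _ (phi d.1)
  (fun x => if d.2 then 1 - clamp (f x) else clamp (f x))).
- exact: (cw1_continuous S).
- by case: d.2; cont.
- by move=> x; have := clamp_itv (f x); rewrite in_itv /=; case: d.2; lra.
Qed.

Lemma dart_path_rev d t : dart_path (dart_rev d) t = dart_path d (1 - t).
Proof.
rewrite /dart_path clampB; case: d => e [] //=; congr phi; lra.
Qed.

Lemma dart_path_V d : V (dart_path d 0) /\ V (dart_path d 1).
Proof.
have [V0 V1] := cw1_boundary S d.1.
rewrite /dart_path clamp0// clamp1// subrr subr0; by case: d.2.
Qed.

Lemma dart_path_nV d t : 0 < t < 1 -> ~ V (dart_path d t).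
Proof.
move=> t01; rewrite /dart_path clamp_id; last lra.
by apply: (cw1_disj0 S); rewrite in_itv /=; case: d.2; lra.
Qed.

Lemma dart_path_edge d d' t t' : 0 < t < 1 -> 0 < t' < 1 ->
  dart_path d t = dart_path d' t' -> d.1 = d'.1.
Proof.
move=> t01 t'01; rewrite /dart_path !clamp_id; [|lra..].
by apply: (cw1_disj1 S); rewrite in_itv /=; case: ifP => _; lra.
Qed.

(** Open edges are embedded and pairwise disjoint, so only the direction of travel is left
    undetermined. *)
Lemma dart_path_inj d d' t t' : 0 < t < 1 -> 0 < t' < 1 ->
  dart_path d t = dart_path d' t' ->
  (d = d' /\ t = t') \/ (d = dart_rev d' /\ t = 1 - t').
Proof.
move=> t01 t'01 dd; have := dart_path_edge t01 t'01 dd; move: dd.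
rewrite /dart_path !clamp_id; [|lra..].
case: d => e b; case: d' => e' b' /= + ee'; rewrite ee' => /(cw1_inj S).
rewrite /dart_rev /=.
by case: b; case: b'; rewrite !in_itv /= => /(_ ltac:(lra) ltac:(lra)) tt;
  [left|right|right|left]; split=> //; lra.
Qed.

End CwTheory.
Arguments dart_path {R X E} phi d t.

(** * Homotopies and paths with time on the whole line *)

Section Homotopies.
Context {R : realType}.
Implicit Types X Y : topologicalType.

(** Asking for continuity on all of [X * R] avoids subspace topologies when homotopies are composed
    and pasted. *)
Definition homotopicR X Y (f g : X -> Y) : Prop :=
  exists H : X * R -> Y,
    [/\ continuous H, forall x, H (x, 0) = f x & forall x, H (x, 1) = g x].

Lemma homotopicR_homotopic X Y (f g : X -> Y) :
  homotopicR f g -> homotopic R f g.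
Proof. by move=> [H [cH H0 H1]]; exists H; split=> //; exact: continuous_subspaceT. Qed.

Lemma homotopicR_continuous X Y (f g : X -> Y) : homotopicR f g -> continuous g.
Proof.
move=> [H [cH _ H1]]; have -> : g = fun x => H (x, 1).
  by apply/funext => x; rewrite H1.
by apply: (cont_comp cH); cont.
Qed.

Lemma homotopicR_trans X Y (f g h : X -> Y) :
  homotopicR f g -> homotopicR g h -> homotopicR f h.
Proof.
move=> [H [cH H0 H1]] [K [cK K0 K1]].
exists (fun z => if z.2 <= 1 / 2 then H (z.1, 2 * z.2) else K (z.1, 2 * z.2 - 1)).
split.
- apply: cont_if_le; [by cont|by cont|..].
  + by apply: (cont_comp cH); cont.
  + by apply: (cont_comp cK); cont.
  + move=> [x s] /= ->.
    have -> : 2 * (1 / 2) = 1 :> R by lra.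
    by rewrite subrr H1 K0.
- by move=> x /=; rewrite ifT ?mulr0//; lra.
- move=> x /=; rewrite ifF; last by apply/negbTE; lra.
  by have -> : 2 * 1 - 1 = 1 :> R by lra.
Qed.

Definition joined Y (a b : Y) : Prop :=
  exists p : R -> Y, [/\ continuous p, p 0 = a & p 1 = b].

Lemma joined_trans Y (a b c : Y) : joined a b -> joined b c -> joined a c.
Proof.
move=> [p [cp p0 p1]] [q [cq q0 q1]].
exists (fun s => if s <= 1 / 2 then p (2 * s) else q (2 * s - 1)); split.
- apply: cont_if_le; [by cont|by cont|..].
  + by apply: (cont_comp cp); cont.
  + by apply: (cont_comp cq); cont.
  + move=> s /= ->.
    have -> : 2 * (1 / 2) = 1 :> R by lra.
    by rewrite subrr p1 q0.
- by rewrite ifT ?mulr0//; lra.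
- rewrite ifF; last by apply/negbTE; lra.
  by have -> : 2 * 1 - 1 = 1 :> R by lra.
Qed.

End Homotopies.
Arguments homotopicR R {X Y} f g.
Arguments joined R {Y} a b.

(** * Deforming maps on the edges of the source *)

Section Deform.
Context {R : realType} {X : topologicalType} {V : set X} {E : Type}
  {phi : E -> R -> X} (S : cw1_structure V phi).

Lemma phi_dart e t : t \in `[0, 1] -> phi e t = dart_path phi (e, false) t.
Proof. by rewrite in_itv => /= t01; rewrite /dart_path/= clamp_id. Qed.

(** The set of points joined to [a] contains every closed edge that it meets, because a path can be
    prolonged along the edge. *)
Lemma graph_joined (a b : X) : connected [set: X] -> joined R a b.
Proof.
move=> conn; suff: [set b | joined R a b] = setT by move=> /seteqP[_ /(_ b I)].
apply: (saturated_setT S) => //.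
  by exists a; exists (fun=> a); split=> //; cont.
move=> e t t' t01 t'01 /= /joined_trans; apply.
exists (fun s => dart_path phi (e, false) (t + s * (t' - t))); split.
- by apply: (cont_dart_path S); cont.
- by rewrite mul0r addr0 phi_dart.
- by rewrite mul1r addrC subrK phi_dart.
Qed.

(* [lam _ s] maps [0, 1] to [-s, 1 + s]; the image of an edge under f is
   extended on [-1, 0] and [1, 2] by paths from the images of its ends to a. *)
Lemma deform_edges (Y : topologicalType) (f : X -> Y) (a : Y)
    (lam : R -> R -> R) :
  continuous f -> (forall b : Y, joined R b a) ->
  continuous (fun p : R * R => lam p.1 p.2) ->
  (forall u, 0 <= u <= 1 -> lam u 0 = u) ->
  (forall s, 0 <= s <= 1 -> lam 0 s = - s) ->
  (forall s, 0 <= s <= 1 -> lam 1 s = 1 + s) ->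
  exists f1 : X -> Y, [/\ homotopicR R f f1,
    forall v, V v -> f1 v = a &
    forall e u, u \in `[0, 1] -> (lam u 1 <= -1) || (2 <= lam u 1) ->
      f1 (phi e u) = a].
Proof.
move=> cf /choice[w wP] clam lamu lam0 lam1.
have cw b : continuous (w b) by case: (wP b).
have w0 b : w b 0 = b by case: (wP b).
have w1 b : w b 1 = a by case: (wP b).
pose c e t := if t <= 0 then w (f (phi e 0)) (clamp (- t)) else
  if t <= 1 then f (dart_path phi (e, false) t)
  else w (f (phi e 1)) (clamp (t - 1)).
have phi0 e : phi e 0 = dart_path phi (e, false) 0.
  by rewrite phi_dart// in_itv /= lexx ler01.
have phi1 e : phi e 1 = dart_path phi (e, false) 1.
  by rewrite phi_dart// in_itv /= lexx ler01.
have cc e : continuous (c e).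
  apply: cont_if_le; [by cont|by cont|..].
  - by apply: (cont_comp (cw _)); cont.
  - apply: cont_if_le; [by cont|by cont|..].
    + by apply: (cont_comp cf); by apply: (cont_dart_path S); cont.
    + by apply: (cont_comp (cw _)); cont.
    + by move=> t ->; rewrite subrr clamp0// w0 phi1.
  - by move=> t ->; rewrite oppr0 clamp0// w0 ler01 phi0.
have cN e s : 0 <= s -> c e (- s) = w (f (phi e 0)) (clamp s).
  by move=> s0; rewrite /c oppr_le0 s0 opprK.
have c1 e s : 0 <= s -> c e (1 + s) = w (f (phi e 1)) (clamp s).
  move=> s0; rewrite /c ifF; last by apply/negbTE; lra.
  case: ifPn => s1; last by rewrite addrAC subrr add0r.
  have -> : s = 0 by lra.
  by rewrite addr0 clamp0// w0 phi1.
have clampK (s : R) : clamp (clamp s) = clamp s by rewrite clamp_id// clamp_itv.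
(* At both ends of an edge the motion is the chosen path [w] from the image of that vertex, whatever
   the edge, so the homotopies of the edges fit together. *)
have [|||| H [cH HV HE]] := @cw_homotopy _ _ _ _ _ S Y
    (fun v s => w (f v) (clamp s)) (fun e u s => c e (lam u (clamp s))).
- by move=> v _; apply: (cont_comp (cw (f v))); cont.
- move=> e; apply: (cont_comp (cc e)).
  by apply: (cont_comp (f := fun p : R * R => (p.1, clamp p.2)) clam); cont.
- by move=> e s; have /andP[s0 s1] := clamp_itv s; rewrite lam0 ?s0 ?cN ?clampK.
- by move=> e s; have /andP[s0 s1] := clamp_itv s; rewrite lam1 ?s0 ?c1 ?clampK.
exists (fun x => H (x, 1)); split.
- exists H; split=> // x.
  case: (cw1_cover S x) => [Vx|[e [u u01 <-]]].
    by rewrite HV// clamp0// w0.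
  have u01' : u \in `[0, 1] by move: u01; rewrite !in_itv /=; lra.
  rewrite HE// clamp0//; move: u01; rewrite in_itv /= => u01.
  rewrite lamu; last lra.
  rewrite /c ifF; last by apply/negbTE; lra.
  by rewrite ifT ?phi_dart//; lra.
- by move=> v Vv; rewrite HV// clamp1// w1.
- move=> e u u01 /orP[l|l]; rewrite HE// clamp1// /c.
    by rewrite ifT ?clamp1 ?w1//; lra.
  by rewrite !ifF ?clamp1 ?w1//; [lra|apply/negbTE; lra..].
Qed.

(* All the movement of f is squeezed into the first half of each edge, that of g
   into the second half. *)
Lemma deform_to_wedge (Y : topologicalType) (f g : X -> Y) (a b : Y) :
  continuous f -> continuous g -> (forall y z : Y, joined R y z) ->
  exists f1 g1 : X -> Y, [/\ homotopicR R f f1, homotopicR R g g1 &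
    forall x, f1 x = a \/ g1 x = b].
Proof.
move=> cf cg jY.
have [f1 [ff1 f1V f1E]] : exists f1 : X -> Y, [/\ homotopicR R f f1,
    forall v, V v -> f1 v = a &
    forall e u, u \in `[0, 1] -> 1 / 2 <= u -> f1 (phi e u) = a].
  (* At [s = 1] this is [Num.min 2 (6 * u - 1)]: it runs from -1 to 2 on the first half of the edge
     and then stays at 2, where the value is [a]. *)
  have [|||||f1 [ff1 f1V f1E]] := @deform_edges Y f a
    (fun u s => Num.min (1 + s) ((1 - s) * u + s * (6 * u - 1))) cf => //.
  - by cont.
  - by move=> u u01; rewrite min_r; lra.
  - by move=> s s01; rewrite min_r; lra.
  - by move=> s s01; rewrite min_l; lra.
  exists f1; split => // e u u01 u1; apply: f1E => //.
  by rewrite le_min; apply/orP; right; lra.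
have [g1 [gg1 g1V g1E]] : exists g1 : X -> Y, [/\ homotopicR R g g1,
    forall v, V v -> g1 v = b &
    forall e u, u \in `[0, 1] -> u <= 1 / 2 -> g1 (phi e u) = b].
  (* At [s = 1] this is [Num.max (-1) (6 * u - 4)]: it rests at -1, where the value is [b], up to
     the midpoint and then runs to 2. *)
  have [|||||g1 [gg1 g1V g1E]] := @deform_edges Y g b
    (fun u s => Num.max (- s) ((1 - s) * u + s * (6 * u - 4))) cg => //.
  - by cont.
  - by move=> u u01; rewrite max_r; lra.
  - by move=> s s01; rewrite max_l; lra.
  - by move=> s s01; rewrite max_r; lra.
  exists g1; split => // e u u01 u1; apply: g1E => //.
  by rewrite ge_max; apply/orP; left; lra.
exists f1, g1; split=> // x.
case: (cw1_cover S x) => [Vx|[e [u u01 <-]]]; first by left; exact: f1V.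
have u01' : u \in `[0, 1] by move: u01; rewrite !in_itv /=; lra.
by case: (leP u (1 / 2)) => [|/ltW] u2; [right; exact: g1E|left; exact: f1E].
Qed.

End Deform.

(** * Pushing two points apart at a branch vertex *)

Section Branch.
Context {R : realType} {Y : topologicalType} {V : set Y} {E : Type}
  {phi : E -> R -> Y} (S : cw1_structure V phi).
Implicit Types d : E * bool.

Let path := dart_path phi.

(** Only the first third of the dart is used, so that even the two arms of a loop meet only at the
    vertex. *)
Definition arm d (t : R) : Y := path d (clamp t / 3).

Lemma arm0 d : arm d 0 = path d 0.
Proof. by rewrite /arm clamp0// mul0r. Qed.

Lemma armE d t : 0 <= t <= 1 -> arm d t = path d (t / 3).
Proof. by move=> t01; rewrite /arm clamp_id. Qed.

Lemma arm_inj d d' t t' :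
  0 < t -> arm d t = arm d' t' -> d = d' /\ clamp t = clamp t'.
Proof.
move=> t0; rewrite /arm => tt'.
have ct0 : 0 < clamp t.
  by case: (leP 1 t) => t1; [rewrite clamp1|rewrite clamp_id; lra].
have := clamp_itv t; have := clamp_itv t'; move: ct0 tt'.
move: (clamp t) (clamp t') => {t0} {}t {}t' t0 tt' t'01 t01.
have nVt : ~ V (path d (t / 3)) by apply: (dart_path_nV S); lra.
case: (eqVneq t' 0) => [t'0|t'0].
  by exfalso; apply: nVt; rewrite tt' t'0 mul0r; case: (dart_path_V S d').
have {}t'0 : 0 < t' by rewrite lt_neqAle eq_sym t'0; lra.
have t3 : 0 < t / 3 < 1 by lra.
have t'3 : 0 < t' / 3 < 1 by lra.
by have [[-> ?]|[_ ?]] := dart_path_inj S t3 t'3 tt'; [split => //|]; lra.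
Qed.

Lemma cont_arm (T : topologicalType) d (f : T -> R) :
  continuous f -> continuous (fun x => arm d (f x)).
Proof. by move=> cf; apply: (cont_dart_path S); cont. Qed.

(** Two arms joined into one line with the vertex at 0; pushing a point through the vertex becomes a
    translation. *)
Definition bent d d' (x : R) : Y := if x <= 0 then arm d (- x) else arm d' x.

Lemma cont_bent (T : topologicalType) d d' (f : T -> R) :
  path d 0 = path d' 0 ->
  continuous f -> continuous (fun x => bent d d' (f x)).
Proof.
move=> dd cf; apply: cont_if_le; [by cont|by cont|..].
- by apply: cont_arm; cont.
- exact: cont_arm.
- by move=> x ->; rewrite oppr0 !arm0.
Qed.

Lemma bentN d d' x : 0 <= x -> bent d d' (- x) = arm d x.
Proof. by move=> x0; rewrite /bent oppr_le0 x0 opprK. Qed.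

(** The two lines share only the arm [d1], because the three darts are distinct. The lower bounds
    keep the parameters in the range where the arm is injective. *)
Lemma bent_off_diagonal d1 d2 d3 x y : d1 <> d2 -> d1 <> d3 -> d2 <> d3 ->
  - 1 <= x -> - 1 <= y -> bent d1 d2 x = bent d1 d3 y -> x = y /\ x <= 0.
Proof.
move=> d12 d13 d23 x1 y1; rewrite /bent.
case: (leP x 0) => x0; case: (leP y 0) => y0.
- case: (eqVneq x 0) => [->|xn0].
    case: (eqVneq y 0) => [->//|yn0].
    have y'0 : 0 < - y by rewrite oppr_gt0 lt_neqAle yn0.
    by move=> /esym /(arm_inj y'0)[_]; rewrite clamp_id; [rewrite clamp_id; lra|lra].
  have x'0 : 0 < - x by rewrite oppr_gt0 lt_neqAle xn0.
  by move=> /(arm_inj x'0)[_]; rewrite clamp_id; [rewrite clamp_id; lra|lra].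
- by move=> /esym /(arm_inj y0)[/esym].
- by move=> /(arm_inj x0)[/esym].
- by move=> /(arm_inj x0)[].
Qed.

Variables d1 d2 d3 : E * bool.
Hypotheses (d12 : d1 <> d2) (d13 : d1 <> d3) (d23 : d2 <> d3).
Hypotheses (b12 : path d1 0 = path d2 0) (b13 : path d1 0 = path d3 0).

Lemma phi_dart_path d t : t \in `[0, 1] ->
  phi d.1 t = path d (if d.2 then 1 - t else t).
Proof.
rewrite in_itv /= => t01; rewrite /path /dart_path clamp_id.
  by case: d.2; congr phi; lra.
by case: d.2; lra.
Qed.

(* Both points are pushed along d1 through the branch vertex, the moving one
   onto d2 and the resting one onto d3. They could only meet on d1, where their
   order is preserved unless the moving point is at arm d1 y0; but then both are
   pushed beyond the vertex. *)
Lemma push_off_point (y0 : R) : 1 / 3 <= y0 <= 2 / 3 ->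
  exists G : Y * R -> Y * Y, [/\ continuous G,
    forall y, G (y, 0) = (y, arm d1 y0),
    forall y, (G (y, 1)).1 <> (G (y, 1)).2 &
    forall t s, 0 <= t <= 1 -> 1 / 3 <= `|t - y0| ->
      G (arm d1 t, s) = (arm d1 t, arm d1 y0)].
Proof.
move=> y012.
pose q := arm d1 y0.
(* A bump of height 1 at [y0] and radius 1/3; by the bounds on [y0] it vanishes at both ends of the
   arm. *)
pose om (t : R) : R := Num.max 0 (1 - 3 * `|t - y0|).
have om_far (t : R) : 1 / 3 <= `|t - y0| -> om t = 0.
  by move=> ?; rewrite /om max_l//; lra.
have om_ge0 t : 0 <= om t by rewrite /om le_max lexx.
(* Here [u] is the parameter on the dart and [3 * u] the one on the arm. Both points are translated
   by the same amount, so the difference of their parameters is kept. *)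
pose g (u s : R) := if u <= 1 / 3
  then (bent d1 d2 (- (3 * u) + s * om (3 * u)), bent d1 d3 (- y0 + s * om (3 * u)))
  else (path d1 u, q).
have gE (u s : R) : 0 <= u <= 1 -> 1 / 3 <= `|3 * u - y0| -> g u s = (path d1 u, q).
  move=> u01 uy; rewrite /g om_far// mulr0 !addr0 !bentN; [|lra..].
  case: ifP => // u3; rewrite armE; last lra.
  by have -> : 3 * u / 3 = u by lra.
have cg (f h : R * R -> R) : continuous f -> continuous h ->
    continuous (fun p => g (f p) (h p)).
  move=> cf ch; apply: cont_if_le; [by cont|by cont|..].
  - by apply: cont_pair; apply: cont_bent => //; rewrite /om; cont.
  - by apply: cont_pair; [apply: (cont_dart_path S)|]; cont.
  - move=> p up; have -> : 3 * f p = 1 by lra.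
    rewrite om_far; last by rewrite ger0_norm; lra.
    rewrite mulr0 !addr0 !bentN; [|lra..].
    by rewrite armE ?up; [|lra].
have i0 : 0 <= (0 : R) <= 1 by lra.
have i1 : 0 <= (1 : R) <= 1 by lra.
have far0 : 1 / 3 <= `|3 * 0 - y0| by rewrite ler0_norm; lra.
have far1 : 1 / 3 <= `|3 * 1 - y0| by rewrite ger0_norm; lra.
pose ori (t : R) := if d1.2 then 1 - clamp t else clamp t.
have [|||| G [cG GV GE]] := @cw_homotopy _ _ _ _ _ S (Y * Y)%type
  (fun v _ => (v, q))
  (fun e t s => if `[< e = d1.1 >] then g (ori t) s else (path (e, false) t, q)).
- by move=> v _; cont.
- move=> e; case: asboolP => _.
    by apply: cg; rewrite /ori; last cont; case: d1.2; cont.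
  by apply: cont_pair; [apply: (cont_dart_path S)|]; cont.
- move=> e s; case: asboolP => [->|_]; last first.
    by rewrite (phi_dart_path (e, false)) ?in_itv /= ?lexx ?ler01.
  rewrite (phi_dart_path d1) /ori ?clamp0 ?in_itv /= ?lexx ?ler01// subr0.
  by case: d1.2; rewrite gE.
- move=> e s; case: asboolP => [->|_]; last first.
    by rewrite (phi_dart_path (e, false)) ?in_itv /= ?lexx ?ler01.
  rewrite (phi_dart_path d1) /ori ?clamp1 ?in_itv /= ?lexx ?ler01// subrr.
  by case: d1.2; rewrite gE.
have Gd1 (u s : R) : 0 <= u <= 1 -> G (path d1 u, s) = g u s.
  move=> u01; rewrite /path /dart_path clamp_id// GE.
    rewrite asboolT// /ori; congr g.
    by case: d1.2; rewrite clamp_id; lra.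
  by rewrite in_itv /=; case: d1.2; lra.
(* A point off the edge of [d1] is never moved and differs from [q], so only that edge needs
   attention. *)
have Gout y : (exists2 u : R, 0 <= u <= 1 & y = path d1 u) \/
    (forall s, G (y, s) = (y, q)) /\ y <> q.
  have nVq : ~ V q.
    by rewrite /q armE; [apply: (dart_path_nV S)|]; lra.
  case: (cw1_cover S y) => [Vy|[e [t]]].
    right; split; first by move=> s'; rewrite GV.
    by move=> yq; apply: nVq; rewrite -yq.
  rewrite in_itv /= => t01 <-.
  have t01' : t \in `[0, 1] by rewrite in_itv /=; lra.
  have [ed|ed] := pselect (e = d1.1).
    left; rewrite ed (phi_dart_path d1)//.
    by exists (if d1.2 then 1 - t else t) => //; case: d1.2; lra.
  right; rewrite (phi_dart_path (e, false) t01') /=; split.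
    move=> s'; rewrite -[path _ t](phi_dart_path (e, false) t01')/=.
    by rewrite GE// asboolF// (phi_dart_path (e, false) t01').
  rewrite /q armE; last lra.
  by move=> /(dart_path_edge S) /= eq; apply: ed; apply: eq; lra.
exists G; split=> //.
- move=> y; case: (Gout y) => [[u u01 ->]|[->//]].
  rewrite Gd1// /g !mul0r !addr0 !bentN; [|lra..].
  case: ifP => // u3; rewrite armE; last lra.
  by have -> : 3 * u / 3 = u by lra.
- move=> y; case: (Gout y) => [[u u01 ->]|[-> //]].
  rewrite Gd1// /g; case: (leP u (1 / 3)) => u3 /=; last first.
    rewrite /q armE; last lra.
    case: (eqVneq u 1) => [->|un1].
      have Vd : V (path d1 1) by case: (dart_path_V S d1).
      by move=> dq; move: Vd; rewrite dq; apply: (dart_path_nV S); lra.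
    have ui : 0 < u < 1 by apply/andP; split; [|rewrite lt_neqAle un1]; lra.
    have y0i : 0 < y0 / 3 < 1 by lra.
    move=> /(dart_path_inj S ui y0i) [[_ ?]|[dd _]]; first lra.
    by move: (congr1 snd dd); rewrite /=; case: d1.2.
  (* Meeting forces [3 * u = y0], where the bump is 1; but then the parameter [- y0 + 1] is
     positive, whereas the meeting point must have one at most 0. *)
  rewrite !mul1r => /(bent_off_diagonal d12 d13 d23) [].
  + by have := om_ge0 (3 * u); lra.
  + by have := om_ge0 (3 * u); lra.
  move=> uy; have -> : 3 * u = y0 by lra.
  by rewrite /om subrr normr0 max_r; lra.
- move=> t s t01 ty; rewrite armE// Gd1; last lra.
  by rewrite gE//; [lra|have -> : 3 * (t / 3) = t by lra].
Qed.

(** Where [g] rests at [q], the homotopy [G] pushes [f] off [q]; elsewhere [f] rests at [a] and [K],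
    with components exchanged, pushes [g] off [a]. The positions 1/3 and 2/3 are just far enough
    apart for both to fix the pair of resting points. *)
Lemma branch_coincidence_free (X : topologicalType) (f g : X -> Y) :
  continuous f -> continuous g ->
  (forall x, f x = arm d1 (1 / 3) \/ g x = arm d1 (2 / 3)) ->
  exists f' g' : X -> Y,
    [/\ homotopicR R f f', homotopicR R g g' & forall x, f' x <> g' x].
Proof.
move=> cf cg fg.
set a := arm d1 (1 / 3) in fg; set q := arm d1 (2 / 3) in fg.
have [G [cG G0 G1 Gfar]] := @push_off_point (2 / 3) ltac:(lra).
have [K [cK K0 K1 Kfar]] := @push_off_point (1 / 3) ltac:(lra).
have hY := cw1_hausdorff S.
have clpt (h : X -> Y) (y : Y) : continuous h ->
    closed [set z : X * R | h z.1 = y].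
  move=> ch.
  have -> : [set z : X * R | h z.1 = y] = (fun z : X * R => h z.1) @^-1` [set y].
    by [].
  apply: closed_comp; first by move=> z _; apply: (cont_comp ch); cont.
  by apply: compact_closed => //; exact: compact_set1.
pose H (z : X * R) := if `[< g z.1 = q >] then G (f z.1, z.2)
  else ((K (g z.1, z.2)).2, (K (g z.1, z.2)).1).
have cH : continuous H.
  apply: (@cont_glue _ _ [set z | g z.1 = q] [set z | f z.1 = a]).
  - exact: clpt.
  - exact: clpt.
  - by move=> z /asboolP.
  - by move=> z /asboolPn gz; case: (fg z.1).
  - move=> [x s] /= fa gq; rewrite fa gq /a /q Gfar; [|lra|]; last first.
      by rewrite ler0_norm; lra.
    by rewrite Kfar//; [lra|rewrite ger0_norm; lra].
  - apply: continuous_subspaceT; apply: (cont_comp cG).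
    by apply: cont_pair; [apply: (cont_comp cf)|]; cont.
  - have cKg : continuous (fun z : X * R => K (g z.1, z.2)).
      apply: (cont_comp cK).
      by apply: cont_pair; [apply: (cont_comp cg)|]; cont.
    by apply: continuous_subspaceT; cont.
have H0 x : H (x, 0) = (f x, g x).
  rewrite /H /=; case: asboolP => [gq|ngq]; first by rewrite G0 gq.
  by rewrite K0; case: (fg x) => [->|/ngq].
exists (fun x => (H (x, 1)).1), (fun x => (H (x, 1)).2); split.
- by exists (fun z => (H z).1); split; [cont|move=> x; rewrite H0|].
- by exists (fun z => (H z).2); split; [cont|move=> x; rewrite H0|].
- move=> x; rewrite /H /=; case: asboolP => _; first exact: G1.
  by apply/nesym; exact: K1.
Qed.

End Branch.

(** * Chains of edges, and contraction of a tree *)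

Section Chains.
Context {R : realType} {Y : topologicalType} {V : set Y} {E : Type}
  {phi : E -> R -> Y} (S : cw1_structure V phi).
Implicit Types (d : E * bool) (e : E) (u v w : Y).

Let dpath := dart_path phi.

(** The edge [e] is the forbidden one. A boolean relation gives access to paths in sequences and
    their shortening to simple ones. *)
Definition step e : rel Y := fun u w =>
  `[< exists d, [/\ d.1 <> e, dpath d 0 = u & dpath d 1 = w] >].

Definition chained e u w : Prop :=
  exists2 p : seq Y, path (step e) u p & last u p = w.

Lemma step_sym e : symmetric (step e).
Proof.
suff H u w : step e u w -> step e w u by move=> u w; apply/idP/idP; exact: H.
move=> /asboolP[d [de du dw]]; apply/asboolP; exists (dart_rev d).
by rewrite /dpath !dart_path_rev subr0 subrr.
Qed.

Lemma chained_trans e u v w : chained e u v -> chained e v w -> chained e u w.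
Proof.
move=> [p pp pl] [q qp ql]; exists (p ++ q); last by rewrite last_cat pl.
by rewrite cat_path pp pl.
Qed.

Lemma chained_sym e u w : chained e u w -> chained e w u.
Proof.
move=> [p pp pl]; exists (rev (belast u p)).
  rewrite -pl rev_path; apply: sub_path pp => x y.
  by rewrite step_sym.
by case: p pl {pp} => [//|x p] _; rewrite /= rev_cons last_rcons.
Qed.

Fixpoint reach (r : Y) n v : Prop :=
  if n is n'.+1 then exists d, dpath d 0 = v /\ reach r n' (dpath d 1)
  else v = r.

Lemma phi_interval e t : 0 <= t <= 1 -> phi e t = dpath (e, false) t.
Proof. by move=> t01; rewrite phi_dart// in_itv /=. Qed.

(** The vertices that reach [r], together with the open edges between them, contain every closed
    edge that they meet, since either end of an edge reaches [r] through the other. *)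
Lemma reach_vertex (r v : Y) :
  connected [set: Y] -> V r -> V v -> exists n, reach r n v.
Proof.
move=> conn Vr Vv.
pose good e := exists n, reach r n (dpath (e, false) 0).
have good1 e n : reach r n (dpath (e, false) 1) -> good e.
  by move=> h; exists n.+1; exists (e, false).
have good1' e : good e -> exists n, reach r n (dpath (e, false) 1).
  move=> [n h]; exists n.+1; exists (e, true).
  have -> : (e, true) = dart_rev (e, false) by [].
  by rewrite /dpath !dart_path_rev subr0 subrr.
pose C := [set y | (V y /\ exists n, reach r n y) \/
  exists e t, [/\ 0 < t < 1, y = dpath (e, false) t & good e]].
suff CT : C = setT.
  have : C v by rewrite CT.
  by move=> [[]//|[e [t [t01 vt _]]]]; case: (dart_path_nV S t01 (d := (e, false))); rewrite -[dart_path _ _ _]vt.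
apply: (saturated_setT S) => //; first by exists r; left; split=> //; exists 0%N.
move=> e t t'; rewrite !in_itv /= => t01 t'01 Ct.
have ge : good e.
  move: Ct; rewrite phi_interval//.
  have := endpoint_or_interior (t := t); rewrite !in_itv /= => /(_ t01)[->|->|ti].
  - case=> [[_]//|[e' [s [s01 es _]]]].
    by case: (dart_path_nV S s01 (d := (e', false))); rewrite -[dart_path _ _ _]es; case: (dart_path_V S (e, false)).
  - case=> [[_ [n]]|[e' [s [s01 es _]]]]; first exact: good1.
    by case: (dart_path_nV S s01 (d := (e', false))); rewrite -[dart_path _ _ _]es; case: (dart_path_V S (e, false)).
  - case=> [[/(dart_path_nV S ti)//]|[e' [s [s01 es]]]].
    by have /= -> := dart_path_edge S ti s01 es.
rewrite phi_interval//.
have := endpoint_or_interior (t := t'); rewrite !in_itv /= => /(_ t'01)[->|->|ti].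
- by left; split => //; case: (dart_path_V S (e, false)).
- by left; split; [case: (dart_path_V S (e, false))|exact: good1'].
- by right; exists e, t'.
Qed.

Definition concat (p q : R -> Y) (s : R) : Y :=
  if s <= 1 / 2 then p (2 * s) else q (2 * s - 1).

Lemma concat_cont (p q : R -> Y) :
  continuous p -> continuous q -> p 1 = q 0 -> continuous (concat p q).
Proof.
move=> cp cq pq; apply: cont_if_le; [by cont|by cont|..].
- by apply: (cont_comp cp); cont.
- by apply: (cont_comp cq); cont.
- move=> s /= ->.
  have -> : 2 * (1 / 2) = 1 :> R by lra.
  by rewrite subrr.
Qed.

Lemma concatl (p q : R -> Y) t : t <= 1 -> concat p q (t / 2) = p t.
Proof.
by move=> t1; rewrite /concat ifT; [have -> : 2 * (t / 2) = t by lra|lra].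
Qed.

Lemma concatr (p q : R -> Y) t :
  p 1 = q 0 -> 0 <= t -> concat p q (1 / 2 + t / 2) = q t.
Proof.
move=> pq t0; rewrite /concat; case: ifPn => [t0'|_].
  have -> : t = 0 by lra.
  by have -> : 2 * (1 / 2 + 0 / 2) = 1 :> R by lra.
by have -> : 2 * (1 / 2 + t / 2) - 1 = t by lra.
Qed.

Lemma concat0 (p q : R -> Y) : concat p q 0 = p 0.
Proof. by have := concatl p q ler01; rewrite mul0r. Qed.

Lemma concat1 (p q : R -> Y) : p 1 = q 0 -> concat p q 1 = q 1.
Proof. by move=> pq; have := concatr pq ler01; have -> : 1 / 2 + 1 / 2 = 1 :> R by lra. Qed.

(* Each edge joins a vertex to the next vertex on its way delta to the root r,
   since two ways to r avoiding an edge e would chain the ends of e. *)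
Lemma bridges_contractible (e0 : E) (r : Y) :
  connected [set: Y] -> V r ->
  (forall e, ~ chained e (phi e 1) (phi e 0)) ->
  exists H : Y * R -> Y,
    [/\ continuous H, forall y, H (y, 0) = y & forall y, H (y, 1) = r].
Proof.
move=> conn Vr bridges.
have V1 d : V (dpath d 1) by case: (dart_path_V S d).
(* [dep v] is the least number of darts leading from [v] to [r]; points off [V] get the default
   0. *)
have /choice[dep depP] : forall v, exists n, V v ->
    reach r n v /\ forall m, reach r m v -> (n <= m)%N.
  move=> v; have [Vv|nVv] := pselect (V v); last by exists 0%N.
  have [n rn] := reach_vertex conn Vr Vv.
  have ex : exists n, `[< reach r n v >] by exists n; apply/asboolP.
  exists (ex_minn ex) => _; case: ex_minnP => m /asboolP rm mmin.
  by split=> // k rk; apply: mmin; apply/asboolP.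
(* [par v] is the first dart of a shortest way to [r], with [(e0, true)] as default at [r] and off
   [V]. *)
have /choice[par parP] : forall v, exists d : E * bool, V v -> v <> r ->
    dpath d 0 = v /\ (dep (dpath d 1%R) < dep v)%N.
  move=> v; have [Vv|nVv] := pselect (V v); last by exists (e0, true).
  case: (depP v Vv); case: (dep v) => [/= vr _|n /= [d [d0 rd]] _].
    by exists (e0, true) => _ /(_ vr).
  exists d => _ _; split=> //; rewrite ltnS.
  by have [_] := depP _ (V1 d); exact.
pose next v := dpath (par v) 1.
(* [n] is fuel for following [par]; by [dl_stable] every amount from [dep v] on gives the same
   path. *)
pose dl := fix dl (n : nat) (v : Y) {struct n} : R -> Y := if n is n'.+1
  then if `[< v = r >] then fun=> r else concat (dpath (par v)) (dl n' (next v))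
  else fun=> r.
have dl_stable n m v : V v -> (dep v <= n)%N -> (dep v <= m)%N ->
    dl n v = dl m v.
  elim: n m v => [|n IH] [|m] v Vv //=.
  - rewrite leqn0 => /eqP dv0 _; case: asboolP => // vr.
    by have [_] := parP v Vv vr; rewrite dv0.
  - rewrite leqn0 => _ /eqP dv0; case: asboolP => // vr.
    by have [_] := parP v Vv vr; rewrite dv0.
  - case: asboolP => // vr dvn dvm; congr concat.
    have [_ dn] := parP v Vv vr.
    by apply: IH; [exact: V1|exact: leq_trans dn dvn|exact: leq_trans dn dvm].
pose delta v := dl (dep v) v.
have delta_r s : delta r s = r.
  by rewrite /delta; case: (dep r) => //= n; rewrite asboolT.
have deltaE v : V v -> v <> r -> delta v = concat (dpath (par v)) (delta (next v)).
  move=> Vv vr; have [_ dn] := parP v Vv vr; rewrite /delta.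
  case: (dep v) dn => // n dn /=; rewrite asboolF//; congr concat.
  by apply: dl_stable => //; exact: V1.
have deltaP v : V v -> [/\ continuous (delta v), delta v 0 = v & delta v 1 = r].
  have [n] := ubnP (dep v); elim: n v => // n IH v dvn Vv.
  have [->|vr] := pselect (v = r).
    by split; rewrite ?delta_r//; rewrite (_ : delta r = fun=> r);
      [cont|apply/funext => s].
  have [p0 dn] := parP v Vv vr.
  have [cn n0 n1] := IH _ (leq_trans dn dvn) (V1 _).
  rewrite deltaE//; split.
  - by apply: concat_cont => //; apply: (cont_dart_path S); cont.
  - by rewrite concat0.
  - by rewrite concat1.
(* Otherwise the ways to [r] from both ends of [e] avoid [e], and [e] is not a bridge. *)
have par_edge e : exists b, dpath (e, b) 0 <> r /\ par (dpath (e, b) 0) = (e, b).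
  apply: contrapT => npar; apply: (bridges e).
  have to_root v : V v -> chained e v r.
    have [n] := ubnP (dep v); elim: n v => // n IH v dvn Vv.
    have [->|vr] := pselect (v = r); first by exists [::].
    have [p0 dn] := parP v Vv vr.
    apply: (chained_trans _ (IH _ (leq_trans dn dvn) (V1 _))).
    exists [:: next v] => //=; rewrite andbT; apply/asboolP; exists (par v).
    split=> // pe; apply: npar; exists (par v).2.
    by rewrite -pe -surjective_pairing p0.
  have [Ve0 Ve1] := cw1_boundary S e.
  exact: chained_trans (to_root _ Ve1) (chained_sym (to_root _ Ve0)).
have /choice[ori oriP] := par_edge.
pose coord e (u : R) : R := if ori e then 1 - clamp u else clamp u.
pose F e := delta (dpath (e, ori e) 0).
have FP e : [/\ continuous (F e), F e 0 = dpath (e, ori e) 0 & F e 1 = r].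
  by apply: deltaP; case: (dart_path_V S (e, ori e)).
have FE e : F e = concat (dpath (e, ori e)) (delta (dpath (e, ori e) 1)).
  have [nr pe] := oriP e; rewrite /F deltaE//; first by rewrite /next pe.
  by case: (dart_path_V S (e, ori e)).
have delta0 d : delta (dpath d 1) 0 = dpath d 1 by case: (deltaP _ (V1 d)).
(* [F e] spends its first half on the edge, so a point with coordinate [c] sits at [c / 2] and moves
   linearly from there to 1. At both ends of the edge this motion is [delta], as the values on
   vertices require. *)
have ends e s : F e (0 / 2 + clamp s * (1 - 0 / 2)) =
    delta (dpath (e, ori e) 0) (clamp s) /\
    F e (1 / 2 + clamp s * (1 - 1 / 2)) = delta (dpath (e, ori e) 1) (clamp s).
  split; first by rewrite mul0r subr0 mulr1 add0r.
  have -> : clamp s * (1 - 1 / 2) = clamp s / 2 by lra.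
  by rewrite FE concatr//; have /andP[] := clamp_itv s.
have phi0 e : phi e 0 = dpath (e, false) 0 by rewrite phi_interval// lexx ler01.
have phi1 e : phi e 1 = dpath (e, false) 1 by rewrite phi_interval// lexx ler01.
have revE e : dpath (e, true) 0 = dpath (e, false) 1 /\
    dpath (e, true) 1 = dpath (e, false) 0.
  have -> : (e, true) = dart_rev (e, false) by [].
  by rewrite /dpath !dart_path_rev subr0 subrr.
have [|||| H [cH HV HE]] := @cw_homotopy _ _ _ _ _ S Y
  (fun v s => delta v (clamp s))
  (fun e (u : R) s => F e (coord e u / 2 + clamp s * (1 - coord e u / 2))).
- by move=> v Vv; have [cd _ _] := deltaP v Vv; apply: (cont_comp cd); cont.
- move=> e; have [cd _ _] := FP e.
  by apply: (cont_comp cd); rewrite /coord; case: (ori e); cont.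
- move=> e s; rewrite /coord phi0 clamp0//.
  have := ends e s; have := revE e; case: (ori e) => -[r0 r1] [E0 E1].
    by rewrite subr0 E1 r1.
  by rewrite E0.
- move=> e s; rewrite /coord phi1 clamp1//.
  have := ends e s; have := revE e; case: (ori e) => -[r0 r1] [E0 E1].
    by rewrite subrr E0 r0.
  by rewrite E1.
exists H; split=> // y; case: (cw1_cover S y) => [Vy|[e [u]]].
- by rewrite HV// clamp0//; case: (deltaP y Vy).
- rewrite in_itv /= => u01 <-.
  have ui : u \in `[0, 1] by rewrite in_itv /=; lra.
  rewrite HE// clamp0// mul0r addr0 FE concatl; last first.
    by rewrite /coord clamp_id; [case: (ori e)|]; lra.
  rewrite phi_interval; last lra.
  rewrite /coord clamp_id; last lra.
  case: (ori e) => //.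
  have -> : (e, true) = dart_rev (e, false) by [].
  by rewrite /dpath dart_path_rev; congr dart_path; lra.
- by rewrite HV// clamp1//; case: (deltaP y Vy).
- rewrite in_itv /= => u01 <-.
  have ui : u \in `[0, 1] by rewrite in_itv /=; lra.
  rewrite HE// clamp1// mul1r addrCA subrr addr0.
  by case: (FP e).
Qed.

End Chains.

(** * Recognizing the circle as a union of two arcs *)

Section Circle.
Context {R : realType} {Y : topologicalType}.

Lemma cont_sqrt (T : topologicalType) (f : T -> R) :
  continuous f -> continuous (fun x => Num.sqrt (f x)).
Proof. by move=> cf x; apply: continuous_comp; [exact: cf|exact: sqrt_continuous]. Qed.

Lemma cont_sqr (T : topologicalType) (f : T -> R) :
  continuous f -> continuous (fun x => f x ^+ 2).
Proof. by move=> cf; apply: (cont_mul cf cf). Qed.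

Let circle := set_type (unit_circle R).

Lemma cont_set_val : continuous (set_val : circle -> R * R).
Proof. exact: initial_continuous. Qed.

Lemma cont_into_circle (f : R -> circle) :
  continuous (fun s => set_val (f s)) -> continuous f.
Proof. by move=> cf; exact: continuous_comp_initial. Qed.


(** The upper half circle is sent along [p] and the lower one along [q], both by means of the first
    coordinate. This is a continuous bijection [k] from a compact space to a Hausdorff one. *)
Lemma homeomorphic_circle (p q : R -> Y) :
  hausdorff_space Y -> continuous p -> continuous q ->
  p 0 = q 1 -> p 1 = q 0 ->
  (forall s t, 0 <= s <= 1 -> 0 <= t <= 1 -> p s = p t -> s = t) ->
  (forall s t, 0 <= s <= 1 -> 0 <= t <= 1 -> q s = q t -> s = t) ->
  (forall s t, 0 <= s <= 1 -> 0 <= t <= 1 -> p s = q t ->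
     (s = 0 /\ t = 1) \/ (s = 1 /\ t = 0)) ->
  (forall y, exists2 t, 0 <= t <= 1 & y = p t \/ y = q t) ->
  homeomorphic Y circle.
Proof.
move=> hY cp cq p0 p1 injp injq pq cover.
pose k (z : circle) := if 0 <= (set_val z).2
  then p ((1 + (set_val z).1) / 2) else q ((1 - (set_val z).1) / 2).
have onC (z : circle) : (set_val z).1 ^+ 2 + (set_val z).2 ^+ 2 = 1.
  exact: (set_valP z).
have x_itv (z : circle) : -1 <= (set_val z).1 <= 1.
  have := onC z; move: (set_val z) => [x y] /= xy.
  have := sqr_ge0 y; have : x ^+ 2 = x * x by []; nra.
have ck : continuous k.
  have c1 : continuous (fun z : circle => (set_val z).1).
    exact: (cont_fst cont_set_val).
  have c2 : continuous (fun z : circle => (set_val z).2).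
    exact: (cont_snd cont_set_val).
  apply: cont_if_le; [by cont|by cont|..].
  - by apply: (cont_comp cp); cont.
  - by apply: (cont_comp cq); cont.
  - move=> z y0; have := onC z; rewrite -y0 expr0n addr0 => /eqP.
    rewrite sqrf_eq1 => /orP[|] /eqP ->.
      by rewrite subrr mul0r -p1; congr p; lra.
    by rewrite subrr mul0r p0; congr q; lra.
have upP s : unit_circle R (2 * clamp s - 1, Num.sqrt (1 - (2 * clamp s - 1) ^+ 2)).
  rewrite /unit_circle /= sqr_sqrtr; first lra.
  by have := clamp_itv s; rewrite expr2; nra.
have loP s : unit_circle R (1 - 2 * clamp s, - Num.sqrt (1 - (1 - 2 * clamp s) ^+ 2)).
  rewrite /unit_circle /= sqrrN sqr_sqrtr; first lra.
  by have := clamp_itv s; rewrite expr2; nra.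
pose up s : circle := exist (fun z => z \in unit_circle R) _ (mem_set (upP s)).
pose lo s : circle := exist (fun z => z \in unit_circle R) _ (mem_set (loP s)).
have cup : continuous up.
  apply: cont_into_circle; apply: cont_pair; first by cont.
  by apply: cont_sqrt; apply: cont_add; [|apply: cont_opp; apply: cont_sqr]; cont.
have clo : continuous lo.
  apply: cont_into_circle; apply: cont_pair; first by cont.
  by apply: cont_opp; apply: cont_sqrt; apply: cont_add; [|apply: cont_opp; apply: cont_sqr]; cont.
have kup s : 0 <= s <= 1 -> k (up s) = p s.
  move=> s01; rewrite /k /= sqrtr_ge0 clamp_id//; congr p; lra.
have klo s : 0 <= s <= 1 -> k (lo s) = q s.
  move=> s01; rewrite /k /= clamp_id// oppr_ge0.
  (* [k] uses [p] when the second coordinate is 0; on the lower half this happens only at the ends,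
     which [p] and [q] share. *)
  case: ifPn => [sq|_]; last by congr q; lra.
  have : 1 - (1 - 2 * s) ^+ 2 <= 0.
    by rewrite -sqrtr_eq0 eq_le sq sqrtr_ge0.
  move=> sq'; have [->|->] : s = 0 \/ s = 1.
  - have : s * (1 - s) == 0 by rewrite expr2 in sq'; apply/eqP; nra.
    by rewrite mulf_eq0 => /orP[|] /eqP; [left|right]; lra.
  - by rewrite -p1; congr p; lra.
  - by rewrite -p0; congr p; lra.
have circle_eq (z z' : circle) : (set_val z).1 = (set_val z').1 ->
    (0 <= (set_val z).2) = (0 <= (set_val z').2) -> z = z'.
  move=> xx yy; apply: val_inj; move: xx yy (onC z) (onC z') => /=.
  rewrite /set_val /=.
  case: (val z) (val z') => [x y] [x' y'] /= <- yy xy xy'; congr pair.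
  have : y ^+ 2 = y' ^+ 2 by lra.
  move=> /eqP; rewrite eqf_sqr => /orP[/eqP//|/eqP yN].
  by move: yy; rewrite yN oppr_ge0; case: (leP y' 0); case: (leP 0 y') => //; lra.
have kinj : injective k.
  move=> z z'; have := x_itv z; have := x_itv z'; have := onC z; have := onC z'.
  rewrite /k; case: ifPn => y0; case: ifPn => y0' C C' I I'.
  - move=> /injp h; apply: circle_eq; rewrite ?y0 ?y0'//.
    by have := h ltac:(lra) ltac:(lra); lra.
  (* The arcs meet only at their ends, where the first coordinate is 1 or -1 and the second is
     therefore 0, against the sign assumed. *)
  - move=> /pq h; exfalso; move/negP: y0'; apply.
    have xx : (set_val z').1 ^+ 2 = 1.
      by case: (h ltac:(lra) ltac:(lra)) => -[_ ?];
        [have -> : (set_val z').1 = -1 by lra|have -> : (set_val z').1 = 1 by lra];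
        rewrite ?sqrrN expr1n.
    have : (set_val z').2 ^+ 2 = 0 by lra.
    by move=> /eqP; rewrite sqrf_eq0 => /eqP ->.
  - move=> /esym /pq h; exfalso; move/negP: y0; apply.
    have xx : (set_val z).1 ^+ 2 = 1.
      by case: (h ltac:(lra) ltac:(lra)) => -[_ ?];
        [have -> : (set_val z).1 = -1 by lra|have -> : (set_val z).1 = 1 by lra];
        rewrite ?sqrrN expr1n.
    have : (set_val z).2 ^+ 2 = 0 by lra.
    by move=> /eqP; rewrite sqrf_eq0 => /eqP ->.
  - move=> /injq h; apply: circle_eq; rewrite ?(negbTE y0) ?(negbTE y0')//.
    by have := h ltac:(lra) ltac:(lra); lra.
have /choice[h hP] : forall y, exists z, k z = y.
  move=> y; have [t t01 [->|->]] := cover y; [exists (up t)|exists (lo t)];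
    [exact: kup|exact: klo].
have hK z : h (k z) = z by apply: kinj; rewrite hP.
exists h, k; split => //.
apply/continuous_closedP => A clA.
(* Closed subsets of the unit interval are compact, so their images under [p] and [q] are closed in
   [Y]. *)
have -> : h @^-1` A = (p @` (`[0, 1]%classic `&` up @^-1` A)) `|`
    (q @` (`[0, 1]%classic `&` lo @^-1` A)).
  apply/seteqP; split => [y /= Ahy|y].
    have [t t01 [yt|yt]] := cover y; [left|right]; exists t => //.
      by split; [rewrite /= in_itv|rewrite /= -(hK (up t)) kup// -yt].
    by split; [rewrite /= in_itv|rewrite /= -(hK (lo t)) klo// -yt].
  case=> -[t [/=]]; rewrite in_itv /= => t01 At <-.
    by rewrite -kup// hK.
  by rewrite -klo// hK.
have clim (r : R -> Y) (w : R -> circle) : continuous r -> continuous w ->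
    closed (r @` (`[0, 1]%classic `&` w @^-1` A)).
  move=> cr cw; apply: compact_closed => //.
  apply: continuous_compact; first exact: continuous_subspaceT.
  apply: compact_closedI; first exact: segment_compact.
  by move/continuous_closedP: cw; exact.
by apply: closedU; exact: clim.
Qed.

End Circle.

(** * The cycle through an edge that is not a bridge *)

Section Cycles.
Context {R : realType} {Y : topologicalType} {V : set Y} {E : Type}
  {phi : E -> R -> Y} (S : cw1_structure V phi).
Implicit Types (d : E * bool) (e : E).

Let dpath := dart_path phi.

Lemma dart_path_inj_closed d s t : dpath d 0 <> dpath d 1 ->
  0 <= s <= 1 -> 0 <= t <= 1 -> dpath d s = dpath d t -> s = t.
Proof.
move=> d01 s01 t01.
have [V0 V1] : V (dpath d 0) /\ V (dpath d 1) := dart_path_V S d.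
have nV (u : R) : 0 < u < 1 -> ~ V (dpath d u) := @dart_path_nV _ _ _ _ _ S d u.
have := endpoint_or_interior (t := s); rewrite !in_itv /= => /(_ s01).
have := endpoint_or_interior (t := t); rewrite !in_itv /= => /(_ t01).
case=> [->|->|ti] [->|->|si] // st; try by case: d01.
- by case: (nV s si); rewrite st.
- by case: (nV s si); rewrite st.
- by case: (nV t ti); rewrite -st.
- by case: (nV t ti); rewrite -st.
- have [[_ //]|[dd _]] := dart_path_inj S si ti st.
  by move: (congr1 snd dd); rewrite /=; case: d.2.
Qed.

(* An arc p from the midpoint of e, leaving through its end 1 and then
   following the edges in T, which all differ from e. *)
Record edge_arc (e : E) (T : set E) (l : seq Y) (w : Y) (p : R -> Y) : Prop :=
  EdgeArc {
  arc_cont : continuous p;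
  arc0 : p 0 = dpath (e, false) (1 / 2);
  arc1 : p 1 = w;
  arc_inj : forall s t : R, 0 <= s <= 1 -> 0 <= t <= 1 -> p s = p t -> s = t;
  arc_avoid : ~ T e;
  arc_image : forall t : R, 0 <= t <= 1 -> exists d (u : R), [/\ 0 <= u <= 1,
    p t = dpath d u & T d.1 \/ (d = (e, false) /\ 1 / 2 <= u)];
  arc_half : forall u : R, 1 / 2 <= u <= 1 ->
    exists2 t : R, 0 <= t <= 1 & p t = dpath (e, false) u;
  arc_edges : forall d (u : R), T d.1 -> 0 <= u <= 1 ->
    exists2 t : R, 0 <= t <= 1 & p t = dpath d u;
  arc_vertices : forall t : R, 0 <= t <= 1 -> V (p t) -> p t \in l;
  arc_last : w \in l;
  arc_degree : forall v, v \in l -> exists d,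
    [/\ dpath d 0 = v, T d.1 \/ d.1 = e, d <> (e, false) &
     v <> w -> exists d', [/\ dpath d' 0 = v, T d'.1 \/ d'.1 = e & d' <> d]] }.

Lemma dart_same_edge d d' : d.1 = d'.1 -> d = d' \/ d = dart_rev d'.
Proof. by case: d d' => e [] [e' []] /= ->; [left|right|right|left]. Qed.

Lemma dart_path_interior d d' u u' : 0 < u < 1 -> 0 <= u' <= 1 ->
  dpath d u = dpath d' u' -> d.1 = d'.1.
Proof.
move=> ui u'01 eq; have nVu := dart_path_nV S (d := d) ui.
have [V0 V1] := dart_path_V S d'.
have := endpoint_or_interior (t := u'); rewrite !in_itv /= => /(_ u'01).
case=> [u'E|u'E|u'i]; last exact: (dart_path_edge S ui u'i eq).
- by exfalso; apply: nVu; rewrite -[dart_path _ _ _]/(dpath d u) eq u'E.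
- by exfalso; apply: nVu; rewrite -[dart_path _ _ _]/(dpath d u) eq u'E.
Qed.

(** Induction on the chain, starting from the second half of [e] and appending the last edge. Its
    far end is a new vertex, so the edge is new as well and injectivity is preserved. *)
Lemma edge_arc_exists e (l : seq Y) :
  path.path (step (phi := phi) e) (dpath (e, false) 1) l ->
  uniq (dpath (e, false) 1 :: l) ->
  exists T p, edge_arc e T (dpath (e, false) 1 :: l)
    (last (dpath (e, false) 1) l) p.
Proof.
set v0 := dpath (e, false) 1.
have V01 d : V (dpath d 0) /\ V (dpath d 1) := dart_path_V S d.
have nV d (u : R) : 0 < u < 1 -> ~ V (dpath d u) := @dart_path_nV _ _ _ _ _ S d u.
elim/last_ind: l => [_ _|l w IH].
  exists set0, (fun t => dpath (e, false) (1 / 2 + t / 2)); split => //=.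
  - by apply: (cont_dart_path S); cont.
  - by rewrite mul0r addr0.
  - by have -> : 1 / 2 + 1 / 2 = 1 :> R by lra.
  - move=> s t s01 t01.
    case: (eqVneq s 1) => [->|s1]; case: (eqVneq t 1) => [->|t1] //.
    + have -> : 1 / 2 + 1 / 2 = 1 :> R by lra.
      move=> eq; case: (nV (e, false) (1 / 2 + t / 2)).
        by apply/andP; split; [|move: t1; rewrite neq_lt => /orP[]]; lra.
      by rewrite -eq; case: (V01 (e, false)).
    + have -> : 1 / 2 + 1 / 2 = 1 :> R by lra.
      move=> eq; case: (nV (e, false) (1 / 2 + s / 2)).
        by apply/andP; split; [|move: s1; rewrite neq_lt => /orP[]]; lra.
      by rewrite eq; case: (V01 (e, false)).
    + have si : 0 < 1 / 2 + s / 2 < 1.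
        by apply/andP; split; [|move: s1; rewrite neq_lt => /orP[]]; lra.
      have ti : 0 < 1 / 2 + t / 2 < 1.
        by apply/andP; split; [|move: t1; rewrite neq_lt => /orP[]]; lra.
      by case/(dart_path_inj S si ti) => [[_ ?]|[[]]//]; lra.
  - move=> t t01; exists (e, false), (1 / 2 + t / 2); split=> //; first lra.
    by right; split => //; lra.
  - move=> u u01; exists (2 * u - 1); first lra.
    by congr dart_path; lra.
  - move=> t t01; case: (eqVneq t 1) => [-> _|t1].
      by rewrite inE; apply/eqP; congr dart_path; lra.
    case/nV => //.
    by apply/andP; split; [|move: t1; rewrite neq_lt => /orP[]]; lra.
  - by rewrite inE.
  - move=> v; rewrite inE => /eqP ->; exists (e, true); split=> //.
      have -> : (e, true) = dart_rev (e, false) by [].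
      by rewrite /dpath dart_path_rev subr0.
    by right.
rewrite rcons_path => /andP[pl /asboolP[d [de d0 d1]]].
rewrite -rcons_cons rcons_uniq => /andP[wl ul].
have [T [p [cp p0 p1 pinj nTe pim phalf pedges pvert plast pdeg]]] := IH pl ul.
have {}d0 : dpath d 0 = last v0 l := d0.
have {}d1 : dpath d 1 = w := d1.
set v := last v0 l in p1 plast pdeg d0 *.
have Vw : V w by rewrite -d1; case: (V01 d).
have nTd : ~ T d.1.
  move=> Td; move/negP: wl; apply; rewrite -d1.
  have [t t01 pt] : exists2 t : R, 0 <= t <= 1 & p t = dpath d 1.
    by apply: pedges => //; lra.
  by rewrite -pt; apply: pvert => //; rewrite pt d1.
have dnw : dpath d 0 <> dpath d 1.
  by rewrite d0 d1 => vw; move: wl; rewrite -vw plast.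
(* Apart from its start, the new edge is disjoint from the old arc. *)
have pd t u : 0 <= t <= 1 -> 0 < u <= 1 -> p t <> dpath d u.
  move=> t01 u01; case: (eqVneq u 1) => [->|u1].
    rewrite d1 => pw; move/negP: wl; apply; rewrite -pw.
    by apply: pvert => //; rewrite pw.
  have ui : 0 < u < 1.
    by apply/andP; split; [|move: u1; rewrite neq_lt => /orP[]]; lra.
  have [d' [u' [u'01 -> Td']]] := pim t t01.
  move=> /esym /(dart_path_interior ui u'01) dd'.
  by case: Td' => [|[d'e _]]; [rewrite -dd'|apply: de; rewrite dd' d'e].
have p1d : p 1 = dpath d 0 by rewrite p1 d0.
exists (T `|` [set d.1]), (concat p (dpath d)); split.
- by apply: concat_cont => //; apply: (cont_dart_path S); cont.
- by rewrite concat0.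
- by rewrite last_rcons concat1.
- move=> s t s01 t01; rewrite /concat.
  case: (leP s (1 / 2)) => s2; case: (leP t (1 / 2)) => t2.
  + by move=> /pinj h; have := h ltac:(lra) ltac:(lra); lra.
  + by move=> /pd h; case: (h ltac:(lra) ltac:(lra)).
  + by move=> /esym /pd h; case: (h ltac:(lra) ltac:(lra)).
  + by move=> /(dart_path_inj_closed dnw) h; have := h ltac:(lra) ltac:(lra); lra.
- by case=> // ed; apply: de.
- move=> t t01; rewrite /concat; case: (leP t (1 / 2)) => t2.
    have [d' [u' [u'01 pt Td']]] := pim (2 * t) ltac:(lra).
    by exists d', u'; split=> //; case: Td' => [Td'|]; [left; left|right].
  by exists d, (2 * t - 1); split=> //; [lra|left; right].
- move=> u u01; have [t t01 pt] := phalf u u01.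
  by exists (t / 2); [lra|rewrite concatl//; lra].
- have dedges u : 0 <= u <= 1 ->
      exists2 t : R, 0 <= t <= 1 & concat p (dpath d) t = dpath d u.
    by move=> u01; exists (1 / 2 + u / 2); [lra|rewrite concatr//; lra].
  move=> d' u [Td'|d'd] u01.
    have [t t01 pt] := pedges d' u Td' u01.
    by exists (t / 2); [lra|rewrite concatl//; lra].
  have [->|->] := dart_same_edge d'd.
  + exact: dedges.
  + rewrite [dpath _ u]dart_path_rev; apply: dedges; lra.
- move=> t t01; rewrite /concat mem_rcons inE.
  case: (leP t (1 / 2)) => t2; first by move=> Vp; rewrite pvert ?orbT//; lra.
  have := endpoint_or_interior (t := 2 * t - 1); rewrite !in_itv /= => /(_ ltac:(lra)).
  case=> [->|->|ti]; [|by rewrite d1 eqxx|by move/(nV _ _ ti)].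
  by rewrite d0 plast orbT.
- by rewrite last_rcons mem_rcons inE eqxx.
- move=> x; rewrite mem_rcons inE last_rcons => /orP[/eqP ->|xl].
    exists (dart_rev d); split=> //.
    + by rewrite /dpath dart_path_rev subr0.
    + by left; right.
    + by move=> /(congr1 fst).
  have [d' [d'0 Td' d'e d'2]] := pdeg x xl.
  have T'd' d'' : T d''.1 \/ d''.1 = e -> (T `|` [set d.1]) d''.1 \/ d''.1 = e.
    by case; [left; left|right].
  exists d'; split=> //; first exact: T'd'.
  (* The old last vertex lacked a second dart; [d] becomes that dart. *)
  have [xv _|xv _] := pselect (x = v).
    exists d; split=> //; [by rewrite d0|by left; right|].
    by move=> dd'; move: Td'; rewrite -dd' => -[].
  by have [d'' [? ? ?]] := d'2 xv; exists d''; split=> //; exact: T'd'.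
Qed.

(* Another edge at a vertex of the cycle would make it a branch vertex; hence the
   cycle is open and closed. *)
Lemma cycle_homeomorphic_circle e :
  connected [set: Y] ->
  (forall d1 d2 d3, d1 <> d2 -> d1 <> d3 -> d2 <> d3 ->
    dpath d1 0 = dpath d2 0 -> dpath d1 0 = dpath d3 0 -> False) ->
  chained (phi := phi) e (phi e 1) (phi e 0) ->
  homeomorphic Y (set_type (unit_circle R)).
Proof.
move=> conn nobranch [l0].
have -> : phi e 0 = dpath (e, false) 0 by rewrite phi_interval ?lexx ?ler01.
have -> : phi e 1 = dpath (e, false) 1 by rewrite phi_interval ?lexx ?ler01.
(* A chain without repeated vertices is what [edge_arc_exists] asks for. *)
move=> /shortenP[l pl ul _ ll].
have [T [p]] := edge_arc_exists pl ul; rewrite ll => -[].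
move=> cp p0 p1 pinj nTe pim phalf pedges pvert plast pdeg.
have V01 d : V (dpath d 0) /\ V (dpath d 1) := dart_path_V S d.
have nV d (u : R) : 0 < u < 1 -> ~ V (dpath d u) := @dart_path_nV _ _ _ _ _ S d u.
(* The first half of [e], ending at the midpoint where [p] starts; it closes the cycle. *)
pose q (t : R) := dpath (e, false) (t / 2).
have half_inj u u' : 0 <= u <= 1 / 2 -> 0 <= u' < 1 ->
    dpath (e, false) u = dpath (e, false) u' -> u = u'.
  move=> u01 u'01.
  case: (eqVneq u 0) => [->|u0]; case: (eqVneq u' 0) => [->|u'0] //.
  - move=> eq; case: (nV (e, false) u').
      by apply/andP; split; [move: u'0; rewrite neq_lt => /orP[]|]; lra.
    by rewrite -eq; case: (V01 (e, false)).
  - move=> eq; case: (nV (e, false) u).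
      by apply/andP; split; [move: u0; rewrite neq_lt => /orP[]|]; lra.
    by rewrite eq; case: (V01 (e, false)).
  - have ui : 0 < u < 1.
      by apply/andP; split; [move: u0; rewrite neq_lt => /orP[]|]; lra.
    have u'i : 0 < u' < 1.
      by apply/andP; split; [move: u'0; rewrite neq_lt => /orP[]|]; lra.
    by move=> /(dart_path_inj S ui u'i) [[_ //]|[[]]].
have pq s t : 0 <= s <= 1 -> 0 <= t <= 1 -> p s = q t ->
    (s = 0 /\ t = 1) \/ (s = 1 /\ t = 0).
  move=> s01 t01 st.
  case: (eqVneq t 0) => [t0|t0].
    right; split=> //; apply: pinj; [lra|lra|].
    by rewrite st p1 /q t0 mul0r.
  left; have ti : 0 < t / 2 < 1.
    by apply/andP; split; [move: t0; rewrite neq_lt => /orP[]|]; lra.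
  have [d [u [u01 pu Td]]] := pim s s01.
  have ed := dart_path_interior ti u01 (etrans (esym st) pu).
  case: Td => [|[de u2]]; first by rewrite -ed.
  move: pu; rewrite de st /q => tu.
  have u1 : u < 1.
    rewrite lt_neqAle; apply/andP; split; last lra.
    apply/eqP => u1; apply: (nV (e, false) _ ti); rewrite tu u1.
    by case: (V01 (e, false)).
  have tE : t / 2 = u by apply: half_inj tu; lra.
  have t1 : t = 1 by lra.
  split=> //; apply: pinj; [lra|lra|].
  by rewrite st p0 /q t1.
pose C := [set y | exists2 t : R, 0 <= t <= 1 & y = p t \/ y = q t].
have CT : C = setT.
  apply: (saturated_setT S) => //; first by exists (p 0), 0; [lra|left].
  move=> e1 t t'; rewrite !in_itv /= => t01 t'01.
  rewrite (phi_interval e1 t01) (phi_interval e1 t'01).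
  have [ee1|ee1] := pselect (T e1 \/ e1 = e).
    move=> _; case: ee1 => [Te|->].
      have [s s01 ps] := pedges (e1, false) t' Te t'01.
      by exists s => //; left.
    case: (leP t' (1 / 2)) => t2.
      exists (2 * t'); first lra.
      by right; congr dart_path; lra.
    have [s s01 ps] := phalf t' ltac:(lra).
    by exists s => //; left.
  (* An edge off the cycle has no end on it: its dart there would be a third one beside the two of
     the cycle. *)
  have ext v d : v = dpath d 0 -> d.1 = e1 -> C v -> False.
    move=> vd de1 Cv.
    have Vv : V v by rewrite vd; case: (V01 d).
    have vl : v \in dpath (e, false) 1 :: l.
      case: Cv => s s01 [vs|vs].
        by rewrite vs; apply: pvert => //; rewrite -vs.
      case: (eqVneq s 0) => [s0|s0]; first by rewrite vs /q s0 mul0r.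
      exfalso; apply: (nV (e, false) (s / 2)).
        by apply/andP; split; [move: s0; rewrite neq_lt => /orP[]|]; lra.
      by rewrite -[dpath _ _]/(q s) -vs.
    have [d1 [d10 Td1 d1e d12]] := pdeg v vl.
    (* At the last vertex of the arc the second dart is [(e, false)], which was excluded as the
       first one. *)
    have [d2 [d20 Td2 d2d1]] : exists d',
        [/\ dpath d' 0 = v, T d'.1 \/ d'.1 = e & d' <> d1].
      have [ve|] := pselect (v = dpath (e, false) 0); last exact: d12.
      by exists (e, false); split; [|right|apply/nesym].
    apply: (nobranch d1 d2 d).
    - exact/nesym.
    - by move=> dd; apply: ee1; rewrite -de1 -dd.
    - by move=> dd; apply: ee1; rewrite -de1 -dd.
    - by rewrite d10.
    - by rewrite d10.
  have := endpoint_or_interior (t := t); rewrite !in_itv /= => /(_ t01).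
  case=> [->|->|ti].
  - by move=> /(ext _ (e1, false) erefl erefl).
  - move=> /(ext _ (e1, true)) []//.
    have -> : (e1, true) = dart_rev (e1, false) by [].
    by rewrite /dpath dart_path_rev subr0.
  - case=> s s01 [] eq; exfalso; apply: ee1.
      have [d [u [u01 pu Td]]] := pim s s01.
      have /= -> := dart_path_interior ti u01 (etrans eq pu).
      by case: Td => [|[-> _]]; [left|right].
    have s2 : 0 <= s / 2 <= 1 by lra.
    by right; have /= := dart_path_interior ti s2 eq.
apply: (@homeomorphic_circle R Y p q) => //.
- exact: cw1_hausdorff S.
- by apply: (cont_dart_path S); cont.
- by rewrite p1 /q mul0r.
- move=> s t s01 t01 /half_inj h; have := h ltac:(lra) ltac:(lra); lra.
- by move=> y; have : C y by rewrite CT.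
Qed.

End Cycles.

(** * Conclusion by cases on the target graph *)

Unset Implicit Arguments.

Theorem theorem3 (R : realType) (X Y : topologicalType)
    (graphX : is_graph R X) (graphY : is_graph R Y)
    (connX : connected [set: X]) (connY : connected [set: Y])
    (ntX : nontrivial X) (ntY : nontrivial Y)
    (Y_not_circle : ~ homeomorphic Y (set_type (unit_circle R)))
    (f g : X -> Y) (cf : continuous f) (cg : continuous g) :
  exists f' g' : X -> Y,
    [/\ continuous f', continuous g',
        homotopic R f f', homotopic R g g' & Coin f' g' = set0].
Proof.
have [VX [EX [phiX SX]]] := graphX.
have [V [E [phi S]]] := graphY.
suff [f' [g' [ff' gg' fg']]] : exists f' g' : X -> Y,
    [/\ homotopicR R f f', homotopicR R g g' & forall x, f' x <> g' x].
  exists f', g'; split.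
  - exact: homotopicR_continuous ff'.
  - exact: homotopicR_continuous gg'.
  - exact: homotopicR_homotopic.
  - exact: homotopicR_homotopic.
  - by apply/seteqP; split => // x /fg'.
have [[d1 [d2 [d3 [[d12 d13 d23] [b12 b13]]]]]|nobranch] := pselect
    (exists d1 d2 d3 : E * bool, [/\ d1 <> d2, d1 <> d3 & d2 <> d3] /\
      (dart_path phi d1 0 = dart_path phi d2 0 /\
       dart_path phi d1 0 = dart_path phi d3 0)).
  have [f1 [g1 [ff1 gg1 fg1]]] := deform_to_wedge SX
    (arm (phi := phi) d1 (1 / 3)) (arm (phi := phi) d1 (2 / 3)) cf cg
    (fun y z => graph_joined S y z connY).
  have [f' [g' [ff' gg' fg']]] := branch_coincidence_free S d12 d13 d23 b12 b13
    (homotopicR_continuous ff1) (homotopicR_continuous gg1) fg1.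
  exists f', g'; split=> //; first exact: homotopicR_trans ff1 ff'.
  exact: homotopicR_trans gg1 gg'.
have bridges e : ~ chained (phi := phi) e (phi e 1) (phi e 0).
  move=> /(cycle_homeomorphic_circle S connY) h; apply: Y_not_circle; apply: h.
  move=> d1 d2 d3 d12 d13 d23 b12 b13; apply: nobranch.
  by exists d1, d2, d3.
have [[e _]|noE] := pselect (exists e : E, True); last first.
  have [x [y xy]] := ntY; exfalso; apply: xy.
  (* Without edges every nonempty set satisfies the saturation condition, so [Y] would be a single
     point. *)
  have sat : [set x] = [set: Y].
    apply: (saturated_setT S) => //; first by exists x.
    by move=> e; case: noE; exists e.
  by have : [set x] y by rewrite sat.
have [V0 V1] := cw1_boundary S e.
have [H [cH H0 H1]] := bridges_contractible S e connY V0 bridges.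
have [K [cK K0 K1]] := bridges_contractible S e connY V1 bridges.
(* The two ends of a bridge are distinct, since otherwise the empty chain would join them. *)
exists (fun=> phi e 0), (fun=> phi e 1); split.
- exists (fun z => H (f z.1, z.2)); split=> [|x|x] /=; [|exact: H0|exact: H1].
  by apply: (cont_comp cH); apply: cont_pair; [apply: (cont_comp cf)|]; cont.
- exists (fun z => K (g z.1, z.2)); split=> [|x|x] /=; [|exact: K0|exact: K1].
  by apply: (cont_comp cK); apply: cont_pair; [apply: (cont_comp cg)|]; cont.
- by move=> _ eq; apply: (bridges e); exists [::].
Qed.
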